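(* If the risk threshold parameter is $\delta=0$, then the risk-constrained safe set $RS_{\alpha,0}(A)$ is a subset of the probabilistic safe set $S_\alpha(A)$. Furthermore, $$RS_{\alpha,0}(A)=S_1(A)\subseteq S_\alpha(A)\qquad\text{for all }\alpha\in(0,1).$$
   Context: Setting. Consider the discrete-time stochastic system $x_{t+1}=f(x_t,u_t,w_t)$ with state $x_t\in\mathbb{R}^n$, control $u_t\in\mathbb{U}$, where $\mathbb{U}\subseteq\mathbb{R}^m$ is convex, and stochastic disturbance $w_t\in\mathbb{W}\subseteq\mathbb{R}^l$ defined on a filtered probability space $(\Omega,\mathcal{F},\{\mathcal{F}_t\}_{t\ge0},\mathbb{P})$; $w_t$ is $\mathcal{F}_t$-measurable and so is $x_{t+1}$. The $\sigma$-algebra $\mathcal{F}_{t-1}$ represents the information collected up to stage $t-1$, with $\mathcal{F}_{-1}$ trivial. The horizon is $T$, and $\mathcal{T}=\{0,\dots,T-1\}$. Safe set and distance. $A\subseteq\mathbb{R}^n$ is a convex compact Borel set (the desired set for safety), and $\mathrm{dist}(\boldsymbol{x},A):=\inf_{y\in A}\|\boldsymbol{x}-y\|$. Notation: $(a)^+=\max\{a,0\}$. Policies. $\Pi$ is the set of strategies $\pi=(\pi_0,\dots,\pi_{T-1})$ where $\pi_t$ is a stochastic kernel from $H_t$ to $\mathbb{U}$ with $\pi_t(\mathbb{U}\mid h_t)=1$ for all $h_t\in H_t$; $H_t$ is the set of histories $h_t=(x_0,w_0,\dots,x_{t-1},w_{t-1},x_t)$. $\mathbb{P}^\pi$ is the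 probability measure induced by $\pi$, and $\mathrm{CVaR}^\pi_\alpha$ is taken with respect to it. Risk measure. For $\alpha\in(0,1)$, the conditional CVaR is the $\mathcal{F}_{t-1}$-measurable random variable $$\mathrm{CVaR}_\alpha[\mathrm{dist}(x_{t+1},A)\mid\mathcal{F}_{t-1}]:=\min_{Z\in\mathcal{L}_2(\Omega,\mathcal{F}_{t-1},\mathbb{P})} Z+\mathbb{E}\Big[\frac{(\mathrm{dist}(x_{t+1},A)-Z)^+}{1-\alpha}\,\Big|\,\mathcal{F}_{t-1}\Big].$$ Probabilistic safe set (for a probability level $\alpha\in(0,1]$): $$S_\alpha(A):=\{\boldsymbol{x}\in\mathbb{R}^n\mid\exists\pi\in\Pi\text{ s.t. } x_0=\boldsymbol{x},\ \mathbb{P}^\pi(x_t\in A,\ t=1,\dots,T)\ge\alpha\}.$$ Risk-constrained safe set (for $\alpha\in(0,1)$, $\delta\ge0$): $$RS_{\alpha,\delta}(A):=\{\boldsymbol{x}\in\mathbb{R}^n\mid\exists\pi\in\Pi\text{ s.t. } x_0=\boldsymbol{x},\ \mathrm{CVaR}^\pi_\alpha[\mathrm{dist}(x_{t+1},A)\mid\mathcal{F}_{t-1}]\le\delta,\ t\in\mathcal{T}\}.$$ *)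

(* Defs.v *)
From HB Require Import structures.
From mathcomp Require Import all_boot all_order all_algebra.
From mathcomp Require Import all_classical all_reals all_analysis.
From mathcomp Require Import measurable_realfun.

Set Implicit Arguments.
Unset Strict Implicit.
Unset Printing Implicit Defensive.
Import Order.TTheory GRing.Theory Num.Theory.
Import numFieldNormedType.Exports.

Local Open Scope classical_set_scope.
Local Open Scope ring_scope.

(* The Borel sigma-algebra on R^n = 'rV[R]_n. *)
HB.instance Definition _ (R : realType) (p q : nat) :=
  @isMeasurable.Build (sigma_display (@open 'M[R]_(p, q))) 'M[R]_(p, q)
    <<s @open 'M[R]_(p, q) >> (@sigma_algebra0 _ setT _) (@sigma_algebraC _ _)
    (@sigma_algebra_bigcup _ setT _).

Section distance.
Context {R : realType} {n : nat}.
Implicit Types (x y : 'rV[R]_n) (A : set 'rV[R]_n).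

(* The library norm on 'rV[R]_n is the sup norm. *)
Definition enorm x : R := Num.sqrt (\sum_(i < n) x ord0 i ^+ 2).

(* Extended-real valued, so that the distance to the empty set is +oo. *)
Definition dist x A : \bar R := ereal_inf [set (enorm (x - y))%:E | y in A].

End distance.

Section conditional_CVaR.
Context {R : realType} d {T : measurableType d} (P : probability T R).
Variable G : set (set T).
Local Open Scope ereal_scope.

Definition sub_measurable d' (V : measurableType d') (X : T -> V) :=
  forall B : set V, measurable B -> G (X @^-1` B).

(* Y is a version of E[X | G], for X nonnegative, with values in [0, +oo]. *)
Definition is_cond_exp (X Y : T -> \bar R) :=
  [/\ sub_measurable Y, forall t, 0 <= Y t &
      forall B, G B -> \int[P]_(t in B) Y t = \int[P]_(t in B) X t].

Definition L2 (Z : T -> R) := sub_measurable Z /\ Z \in Lfun P 2%:E.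

(* V is a version of Z + E[(X - Z)^+ / (1 - alpha) | G]. *)
Definition is_CVaR_objective (alpha : R) (X : T -> \bar R) (Z : T -> R)
    (V : T -> \bar R) :=
  exists2 E : T -> \bar R,
    is_cond_exp
      (fun t => maxe (X t - (Z t)%:E) 0 * ((1 - alpha)^-1)%:E) E &
    forall t, V t = (Z t)%:E + E t.

(* The minimum is for the P-almost sure order on G-measurable random
   variables, and is required to be attained in L2. *)
Definition is_cond_CVaR (alpha : R) (X Y : T -> \bar R) :=
  [/\ sub_measurable Y,
      exists Z V, [/\ L2 Z, is_CVaR_objective alpha X Z V &
                      {ae P, forall t, Y t = V t}] &
      forall Z V, L2 Z -> is_CVaR_objective alpha X Z V ->
                  {ae P, forall t, Y t <= V t}].

End conditional_CVaR.

(* For mu a probability on X, h : X -> H, k a kernel from H to Y and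
   phi : X * Y -> Z, the law of phi (x, y) when x is drawn from mu and then y
   from k (h x). *)
Section kernel_extension.
Context {R : realType} d d1 d2 d3 {X : measurableType d} {H : measurableType d1}
  {Y : measurableType d2} {Z : measurableType d3}.
Variables (mu : probability X R) (k : R.-pker H ~> Y).
Variables (h : X -> H) (mh : measurable_fun setT h).
Variables (phi : X * Y -> Z) (mphi : measurable_fun setT phi).
Local Open Scope ereal_scope.

Let kh (x : X) : {measure set Y -> \bar R} := k (h x).

Let measurable_kh U : measurable U -> measurable_fun setT (kh ^~ U).
Proof. by move=> mU; exact: measurableT_comp (measurable_kernel k U mU) mh. Qed.

HB.instance Definition _ := isKernel.Build _ _ _ _ R kh measurable_kh.

Let kh_prob x : kh x setT = 1.
Proof. by rewrite /kh prob_kernel. Qed.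

HB.instance Definition _ := Kernel_isProbability.Build _ _ _ _ R kh kh_prob.

Definition kext (B : set Z) : \bar R :=
  \int[mu]_x k (h x) [set y | B (phi (x, y))].

Let msec (B : set Z) x : measurable B -> measurable [set y | B (phi (x, y))].
Proof.
move=> mB; rewrite -[X in measurable X]setTI.
have /(_ measurableT _ mB) := measurableT_comp mphi (measurable_pair1 x).
exact.
Qed.

Let measurable_kext B : measurable B ->
  measurable_fun setT (fun x => k (h x) [set y | B (phi (x, y))]).
Proof.
move=> mB.
have mA : measurable (phi @^-1` B) by rewrite -[X in measurable X]setTI; exact: mphi.
rewrite (_ : (fun _ => _) = (fun x => kh x (xsection (phi @^-1` B) x))); last first.
  by apply/funext => x; rewrite /kh xsectionE.
by apply: measurable_fun_xsection_finite_kernel => //; rewrite inE.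
Qed.

Let kext0 : kext set0 = 0.
Proof.
by apply: integral0_eq => x _; rewrite (_ : [set y | _] = set0) ?measure0.
Qed.

Let kext_ge0 B : 0 <= kext B.
Proof. by apply: integral_ge0 => x _; exact: measure_ge0. Qed.

Let kext_sigma_additive : semi_sigma_additive kext.
Proof.
move=> F mF tF mUF; rewrite [X in _ --> X](_ : _ =
  \int[mu]_x (\sum_(n <oo) k (h x) [set y | F n (phi (x, y))])); last first.
  apply: eq_integral => x _; apply/esym/cvg_lim => //.
  rewrite (_ : [set y | _] = \bigcup_n [set y | F n (phi (x, y))]) //.
  apply: measure_semi_sigma_additive.
  - by move=> i; exact: msec.
  - apply/trivIsetP => i j _ _ ij; apply/seteqP; split => // y /= Fij.
    by move/trivIsetP: tF => /(_ i j I I ij)/seteqP[/(_ _ Fij)].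
  - exact: (msec (B := \bigcup_n F n)).
apply/cvg_closeP; split.
  by apply: is_cvg_nneseries => i _ _; exact: kext_ge0.
by rewrite closeE// integral_nneseries// => i; exact: measurable_kext.
Qed.

HB.instance Definition _ :=
  isMeasure.Build _ _ R kext kext0 kext_ge0 kext_sigma_additive.

Let kext_setT : kext setT = 1.
Proof.
rewrite /kext (eq_integral (cst 1)) => [|x _]; last by rewrite /= prob_kernel.
by rewrite integral_cst// mul1e; exact: probability_setT.
Qed.

HB.instance Definition _ := Measure_isProbability.Build _ _ R kext kext_setT.

Definition kextend : probability Z R := kext.

End kernel_extension.

Section system.
Context {R : realType} {n m l : nat} d {Omega : measurableType d}.
Local Notation X := 'rV[R]_n.
Local Notation UU := 'rV[R]_m.
Local Notation WW := 'rV[R]_l.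

(* ((x_0, w_0), ..., (x_(t-1), w_(t-1))) and x_t *)
Definition history t : Type := (t.-tuple (X * WW) * X)%type.
HB.instance Definition _ t := Measurable.on (history t).

Definition history_set (W : set WW) t : set (history t) :=
  [set h | forall i, W (tnth h.1 i).2].

(* Kernels are defined on all of (R^n * R^l)^t * R^n, the constraint being
   imposed on histories only; only pi_0, ..., pi_(T-1) matter. *)
Definition policy := forall t, R.-pker history t ~> UU.

Definition admissible (U : set UU) (W : set WW) (T : nat) (pi : policy) :=
  forall t, (t < T)%N ->
  forall h : history t, history_set W h -> pi t h U = 1%E.

Variables (f : {mfun (X * UU * WW)%type >-> X}) (w : nat -> {mfun Omega >-> WW}).
Variables (P : probability Omega R) (F : nat -> set (set Omega)).

(* The sample space also carries the controls, which are randomized by the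
   policy. *)
Definition sample T : Type := (Omega * T.-tuple UU)%type.
HB.instance Definition _ T := Measurable.on (sample T).

Definition control T (t : nat) (z : sample T) : UU := nth 0 z.2 t.

Fixpoint state (x0 : X) T (t : nat) (z : sample T) : X :=
  if t is s.+1 then f (state x0 s z, control s z, w s z.1) else x0.

Definition state_history x0 T t (z : sample T) : history t :=
  ([tuple (state x0 i z, w i z.1) | i < t], state x0 t z).

Lemma measurable_control T t : measurable_fun setT (@control T t).
Proof.
have [tT|Tt] := ltnP t T; last first.
  rewrite (_ : @control T t = cst 0); first exact: measurable_cst.
  by apply/funext => z; rewrite /control nth_default// size_tuple.
rewrite (_ : @control T t = (fun z : sample T => tnth z.2 (Ordinal tT))).
  exact: measurableT_comp (measurable_tnth _) measurable_snd.
by apply/funext => z; rewrite /control (tnth_nth 0).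
Qed.

Lemma measurable_state x0 T t : measurable_fun setT (@state x0 T t).
Proof.
elim: t => [|t IH] /=; first exact: measurable_cst.
apply: measurableT_comp => //.
apply/measurable_fun_pair => /=.
  by apply/measurable_fun_pair => //; exact: measurable_control.
exact: measurableT_comp measurable_fst.
Qed.

Lemma measurable_state_history x0 T t :
  measurable_fun setT (@state_history x0 T t).
Proof.
apply/measurable_fun_pair; last exact: measurable_state.
apply/measurable_fun_tnthP => i /=.
rewrite (_ : _ \o _ = (fun z : sample T => (state x0 i z, w i z.1))).
  apply/measurable_fun_pair => /=; first exact: measurable_state.
  exact: measurableT_comp measurable_fst.
by apply/funext => z /=; rewrite tnth_mktuple.
Qed.

Definition add_control t (zu : sample t * UU) : sample t.+1 :=
  (zu.1.1, [tuple of rcons zu.1.2 zu.2]).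

Lemma measurable_add_control t : measurable_fun setT (@add_control t).
Proof.
apply/measurable_fun_pair.
  exact: measurableT_comp measurable_fst measurable_fst.
apply/measurable_fun_tnthP => i /=.
have [it|ti] := ltnP i t.
  rewrite (_ : _ \o _ = (fun zu : sample t * UU => control i zu.1)).
    exact: measurableT_comp (measurable_control _) measurable_fst.
  by apply/funext => zu /=; rewrite (tnth_nth 0)/= nth_rcons size_tuple it.
rewrite (_ : _ \o _ = (fun zu : sample t * UU => zu.2)).
  exact: measurable_snd.
apply/funext => zu /=; rewrite (tnth_nth 0)/= nth_rcons size_tuple ltnNge ti/=.
by rewrite eqn_leq ti -ltnS ltn_ord.
Qed.

Definition no_control (omega : Omega) : sample 0 := (omega, [tuple]).

Lemma measurable_no_control : measurable_fun setT no_control.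
Proof. by apply/measurable_fun_pair => //; exact: measurable_cst. Qed.

HB.instance Definition _ :=
  isMeasurableFun.Build _ _ _ _ no_control measurable_no_control.

(* P^pi: omega follows P and, successively for t < T, u_t follows
   pi_t( . | h_t). *)
Fixpoint policy_prob (x0 : X) (pi : policy) T : probability (sample T) R :=
  match T with
  | 0 => distribution P no_control
  | t.+1 => kextend (policy_prob x0 pi t) (pi t)
              (@measurable_state_history x0 t t) (@measurable_add_control t)
  end.

(* F_(t-1), lifted to the sample space: generated by F_(t-1) on Omega and the
   controls u_0, ..., u_(t-1); trivial for t = 0. *)
Definition info T t : set (set (sample T)) :=
  if t is s.+1 then
    <<s [set E | exists2 B, F s B & E = fst @^-1` B] `|`
        [set E | exists i (C : set UU),
           [/\ (i <= s)%N, measurable C & E = @control T i @^-1` C] ] >>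
  else [set set0; setT].

Definition filtration :=
  [/\ forall t, sigma_algebra setT (F t),
      forall t, F t `<=` measurable &
      forall s t, (s <= t)%N -> F s `<=` F t].

(* With w_t measurable with respect to F_t, so is x_(t+1). *)
Lemma state_sub_measurable x0 T t : filtration ->
  (forall s, sub_measurable (F s) (w s)) ->
  sub_measurable (@info T t) (@state x0 T t).
Proof.
move=> [_ _ Fmono] wF; case: t => [B _|t B mB].
  have [Bx|Bx] := pselect (B x0); [right|left]; apply/seteqP; split=> //= z /Bx.
rewrite /info; set gens := (X in <<s X >>).
pose S := g_sigma_algebraType gens.
have mu i : (i <= t)%N ->
    measurable_fun setT (@control T i : S -> UU).
  move=> it _ C mC; rewrite setTI; apply: sub_sigma_algebra; right.
  by exists i, C.
have mw i : (i <= t)%N -> measurable_fun setT ((fun z => w i z.1) : S -> WW).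
  move=> it _ C mC; rewrite setTI; apply: sub_sigma_algebra; left.
  by exists (w i @^-1` C) => //; apply: (Fmono _ _ it); exact: wF.
suff mx i : (i <= t.+1)%N -> measurable_fun setT (@state x0 T i : S -> X).
  by rewrite -[X in <<s _ >> X]setTI; exact: (mx _ (leqnn _) measurableT _ mB).
elim: i => [_|i IH it] /=; first exact: measurable_cst.
apply: (measurableT_comp (f := f)) => //.
apply/measurable_fun_pair => /=; last exact: mw.
by apply/measurable_fun_pair; [exact: (IH (ltnW it))|exact: mu].
Qed.

Variables (U : set UU) (W : set WW) (T : nat) (A : set X).

Definition prob_safe_set (alpha : R) : set X :=
  [set x | exists2 pi, admissible U W T pi &
     (alpha%:E <= policy_prob x pi T
        [set z | forall t, (1 <= t <= T)%N -> A (state x t z)])%E].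

Definition risk_safe_set (alpha delta : R) : set X :=
  [set x | exists2 pi, admissible U W T pi &
     forall t, (t < T)%N ->
     exists2 Y : sample T -> \bar R,
       is_cond_CVaR (policy_prob x pi T) (@info T t) alpha
         (fun z => dist (state x t.+1 z) A) Y &
       {ae policy_prob x pi T, forall z, (Y z <= delta%:E)%E}].

End system.

(* Main.v *)
Require Import Defs.
From HB Require Import structures.
From mathcomp Require Import all_boot all_order all_algebra.
From mathcomp Require Import all_classical all_reals all_analysis.
From mathcomp Require Import measurable_realfun.
From mathcomp Require Import lra.

Set Implicit Arguments.
Unset Strict Implicit.
Unset Printing Implicit Defensive.
Import Order.TTheory GRing.Theory Num.Theory.
Import numFieldNormedType.Exports.

Local Open Scope classical_set_scope.
Local Open Scope ring_scope.

(** Write X for the nonnegative cost dist (x_(t+1), A) and c for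
1 / (1 - alpha), so that c > 1. Everything rests on one observation about the
objective V = Z + E[(X - Z)^+ c | G] ([integral_eq0_objective_le0]): on a set B
of G where V <= 0, the conditional expectation is nonnegative, so Z <= 0 there,
hence (X - Z)^+ = X + |Z|, and V <= 0 bounds the conditional expectation of
(X + |Z|) c by |Z|. Integrating over B gives
[c (int X + int |Z|) <= int |Z|], where int |Z| is finite because Z is square
integrable; as c > 1, both integrals vanish.

If the conditional CVaR is at most 0, taking for B the whole space shows that
X = 0 almost surely ([cond_CVaR_le0]). Conversely, taking B = {V < 0} shows
that Z = 0 almost everywhere on B, where V < 0 would force Z < 0: so B is null
and every objective is nonnegative ([objective_ge0]). When X = 0 almost surely
the choice Z = 0 attains the value 0, which is therefore the minimum
([cond_CVaR_ae0]). So the risk constraint at level 0 says exactly that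
dist (x_(t+1), A) = 0 almost surely, that is, x_(t+1) lies almost surely in A,
since A is closed ([dist_eq0]); over the finite horizon this is the statement
that the trajectory stays in A with probability 1
([safe_event_probability1P]). The same policy serves on both sides, and the
inclusion in the safe set of level alpha follows from alpha < 1. *)

(** * The distance to a set *)

Section distance_theory.
Context {R : realType} {n : nat}.
Implicit Types (x y : 'rV[R]_n) (A : set 'rV[R]_n).

Lemma enorm0 : enorm (0 : 'rV[R]_n) = 0.
Proof. by rewrite /enorm big1 ?sqrtr0// => i _; rewrite mxE expr0n. Qed.

(** Relates the Euclidean norm to the sup norm that defines the topology. *)
Lemma le_coord_enorm x i : `|x ord0 i| <= enorm x.
Proof.
rewrite -sqrtr_sqr ler_wsqrtr// (bigD1 i)//= lerDl sumr_ge0// => j _.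
exact: sqr_ge0.
Qed.

Lemma continuous_enormB y : continuous (fun x : 'rV[R]_n => enorm (x - y)).
Proof.
have cS : continuous (fun x : 'rV[R]_n => \sum_(i < n) (x - y) ord0 i ^+ 2).
  apply: continuous_big => [|i _ x]; first exact: add_continuous.
  have cB : {for x, continuous (fun x : 'rV[R]_n => (x - y) ord0 i)}.
    have -> : (fun x : 'rV[R]_n => (x - y) ord0 i) =
              (fun x => x ord0 i) \- cst (y ord0 i).
      by apply/funext => z; rewrite !mxE.
    by apply: continuousB; [exact: coord_continuous|exact: cst_continuous].
  exact: (continuousM cB cB).
by move=> x; apply: (continuous_comp (cS x)); exact: sqrt_continuous.
Qed.

Lemma dist_ge0 x A : (0 <= dist x A)%E.
Proof. by apply: le_ereal_inf_tmp => _ [y _ <-]; rewrite lee_fin sqrtr_ge0. Qed.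

Lemma dist_lt x A (c : \bar R) :
  (dist x A < c)%E <-> exists2 y, A y & ((enorm (x - y))%:E < c)%E.
Proof.
split=> [/ereal_inf_lt[_ [y Ay <-] yc]|[y Ay]]; first by exists y.
by apply: le_lt_trans; apply: ereal_inf_lbound; exists y.
Qed.

Lemma dist_eq0 x A : closed A -> dist x A = 0%E <-> A x.
Proof.
move=> cA; split=> [dx|Ax]; last first.
  apply/eqP; rewrite eq_le dist_ge0 andbT; apply: ereal_inf_lbound.
  by exists x => //; rewrite subrr enorm0.
apply: cA => B /nbhs_ballP[e /= e0 eB].
have [|y Ay] := (dist_lt x A e%:E).1; first by rewrite dx lte_fin.
rewrite lte_fin => ye; exists y; split => //; apply: eB; split => // i j.
rewrite ord1 /ball/=; apply: le_lt_trans ye.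
by rewrite -[x ord0 j - _](_ : (x - y) ord0 j = _) ?le_coord_enorm// !mxE.
Qed.

(** The sublevel set of level c is the union over y in A of the open balls of
radius c around y, hence open: no attainment of the infimum is involved, and
the empty set is covered. *)
Lemma measurable_dist A : measurable_fun setT (fun x => dist x A).
Proof.
apply: (measurability _ (ErealGenInftyO.measurableE R)).
move=> _ [_ [c ->] <-]; rewrite setTI; apply: sub_sigma_algebra.
rewrite (_ : _ @^-1` _ =
    \bigcup_(y in A) (fun x => enorm (x - y)) @^-1` [set r | r < c]).
  apply: bigcup_open => y _; apply: open_comp; last exact: open_lt.
  by move=> x _; exact: continuous_enormB.
apply/seteqP; split => x /=.
  by rewrite in_itv/= => /dist_lt[y Ay yc]; exists y => //=; rewrite -lte_fin.
by move=> [y Ay yc]; rewrite in_itv/=; apply/dist_lt; exists y.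
Qed.

End distance_theory.

(** * Conditional CVaR of a nonnegative cost *)

Section conditional_CVaR_theory.
Context {R : realType} d {T : measurableType d} (P : probability T R).
Variable G : set (set T).
Hypothesis sG : sigma_algebra setT G.
Hypothesis Gm : G `<=` measurable.
Local Open Scope ereal_scope.

(** Gives access to the closure properties of measurable functions for
measurability with respect to G. *)
Lemma sub_measurableP d' (V : measurableType d') (X : T -> V) :
  sub_measurable G X <->
  measurable_fun setT (X : g_sigma_algebraType G -> V).
Proof.
have mG (C : set T) : measurable (C : set (g_sigma_algebraType G)) = G C.
  by rewrite -[in RHS](sigma_algebra_id sG).
split=> [GX _ B mB|mX B mB]; first by rewrite setTI mG; exact: GX.
by rewrite -mG -[_ @^-1` _]setTI; exact: mX.
Qed.

Lemma sub_measurable_fun d' (V : measurableType d') (X : T -> V) :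
  sub_measurable G X -> measurable_fun setT X.
Proof. by move=> GX _ B mB; rewrite setTI; exact/Gm/GX. Qed.

Lemma sub_measurable_cst d' (V : measurableType d') (v : V) :
  sub_measurable G (fun _ : T => v).
Proof. by apply/sub_measurableP; exact: measurable_cst. Qed.

(** The factor 1 / (1 - alpha) exceeds 1, so it cannot be absorbed by a finite
b unless both terms vanish: clearing denominators gives a + alpha b <= 0. *)
Lemma eq0_of_add_divr_le (alpha : R) (a b : \bar R) : (0 < alpha < 1)%R ->
  0 <= a -> b \is a fin_num -> 0 <= b ->
  (a + b) * ((1 - alpha)^-1)%:E <= b -> a = 0 /\ b = 0.
Proof.
move=> /andP[a0 a1]; case: b => // b; case: a => [a| |]// ha _ hb; last first.
  by rewrite addye// gt0_mulye// lte_fin invr_gt0 subr_gt0.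
rewrite -EFinD -EFinM lee_fin ler_pdivrMr ?subr_gt0//.
rewrite !lee_fin in ha hb => h; suff [-> ->] : a = 0%R /\ b = 0%R by [].
have ab : (0 <= b * alpha)%R by rewrite mulr_ge0// ltW.
have h' : (a + b * alpha <= 0)%R by rewrite mulrBr mulr1 in h; lra.
have -> : (a = 0)%R by lra.
split=> //; have /eqP : (b * alpha = 0)%R by lra.
by rewrite mulf_eq0 (gt_eqF a0) orbF => /eqP.
Qed.

(** Where Z + E <= 0 one has Z <= 0 and E <= |Z|, while E averages to
(X + |Z|) / (1 - alpha) over B. *)
Lemma integral_eq0_objective_le0 (alpha : R) (X E : T -> \bar R) (Z : T -> R)
    (B : set T) :
  (0 < alpha < 1)%R -> measurable_fun setT X -> (forall t, 0 <= X t) ->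
  L2 P G Z ->
  is_cond_exp P G
    (fun t => maxe (X t - (Z t)%:E) 0 * ((1 - alpha)^-1)%:E) E ->
  G B -> {ae P, forall t, B t -> (Z t)%:E + E t <= 0} ->
  \int[P]_(t in B) X t = 0 /\ \int[P]_(t in B) `|(Z t)%:E| = 0.
Proof.
move=> halpha mX X0 [GZ Z2] [GE E0 intE] GB ZE0.
have mZ := sub_measurable_fun GZ.
have mE := sub_measurable_fun GE.
have mB := Gm GB.
have mN : measurable_fun setT (fun t => `|(Z t)%:E|).
  by apply: measurableT_comp => //; exact/measurable_EFinP.
have [_ a1] := andP halpha.
have c0 : 0 <= ((1 - alpha)^-1)%:E :> \bar R.
  by rewrite lee_fin invr_ge0 subr_ge0 ltW.
apply: (eq0_of_add_divr_le halpha).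
- by apply: integral_ge0 => t _.
- have /integrableP[_] : P.-integrable B (EFin \o Z).
    apply: (integrableS measurableT) => //.
    by apply/Lfun1_integrable; apply: Lfun_subset12 Z2; exact: fin_num_measure.
  rewrite ge0_fin_numE//; exact: integral_ge0.
- exact: integral_ge0.
rewrite -ge0_integralD//; [|exact: measurable_funTS..].
rewrite -ge0_integralZr//; last 2 first.
- by apply: measurable_funTS; exact: emeasurable_funD.
- by move=> t _; exact: adde_ge0.
apply: (@le_trans _ _ (\int[P]_(t in B) E t)); last first.
  apply: ae_ge0_le_integral => //; [exact: measurable_funTS..|].
  apply: filterS ZE0 => t + Bt => /(_ Bt) ZE.
  apply: (@le_trans _ _ (- (Z t)%:E)); last by rewrite -abseN lee_abs.
  by rewrite -[leRHS]sub0e leeBrDl.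
rewrite intE//; apply: ae_ge0_le_integral => //.
- by move=> t _; rewrite mule_ge0// adde_ge0.
- apply: measurable_funTS; apply: emeasurable_funM => //.
  exact: emeasurable_funD.
- by move=> t _; rewrite mule_ge0// le_max lexx orbT.
- apply: measurable_funTS; apply: emeasurable_funM => //.
  apply: measurable_maxe => //; apply: emeasurable_funB => //.
  exact/measurable_EFinP.
apply: filterS ZE0 => t + Bt => /(_ Bt) ZE.
rewrite lee_wpmul2r// le_max; apply/orP; left.
have Z0 : (Z t)%:E <= 0 by apply: le_trans ZE; rewrite leeDl.
by rewrite lee0_abs.
Qed.

(** The minimizer Z of the objective has Z + E <= 0 almost surely; averaging
over the whole space, which belongs to G, gives int X = 0. *)
Lemma cond_CVaR_le0 (alpha : R) (X Y : T -> \bar R) :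
  (0 < alpha < 1)%R -> measurable_fun setT X -> (forall t, 0 <= X t) ->
  is_cond_CVaR P G alpha X Y -> {ae P, forall t, Y t <= 0} ->
  {ae P, forall t, X t = 0}.
Proof.
move=> halpha mX X0 [_ [Z [V [LZ [E cE VE] YV]]] _] Y0.
have GT : G setT by have [G0 GC _] := sG; rewrite -(setD0 setT); exact: GC.
have [|intX _] := integral_eq0_objective_le0 halpha mX X0 LZ cE GT.
  apply: filterS2 YV Y0 => t YVt Yt0 _; by rewrite -VE -YVt.
have : ae_eq P setT X (cst 0).
  apply/ae_eq_integral_abs => //; rewrite -[RHS]intX.
  by apply: eq_integral => t _; rewrite gee0_abs.
by apply: filterS => t; apply.
Qed.

(** The set B = {V < 0} belongs to G, so the defining identity of the
conditional expectation is available on it; Z vanishes almost everywhere on B,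
and there V = E >= 0, a contradiction. *)
Lemma objective_ge0 (alpha : R) (X V : T -> \bar R) (Z : T -> R) :
  (0 < alpha < 1)%R -> measurable_fun setT X -> (forall t, 0 <= X t) ->
  L2 P G Z -> is_CVaR_objective P G alpha X Z V -> {ae P, forall t, 0 <= V t}.
Proof.
move=> halpha mX X0 LZ [E cE VE].
have [GZ _] := LZ; have [GE E0 _] := cE.
pose B := [set t | V t < 0].
have GB : G B.
  rewrite -(sigma_algebra_id sG) -[B]setTI.
  apply: (@emeasurable_fun_infty_o _ (g_sigma_algebraType G)) => //.
  rewrite (_ : V = fun t => (Z t)%:E + E t); last exact/funext.
  apply: emeasurable_funD; last exact/sub_measurableP.
  by apply/measurable_EFinP; exact/sub_measurableP.
have [|_ intZ] := integral_eq0_objective_le0 halpha mX X0 LZ cE GB.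
  by apply: aeW => t Bt; rewrite -VE; exact: ltW.
have : ae_eq P B (EFin \o Z) (cst 0).
  apply/ae_eq_integral_abs => //; first exact: Gm.
  by apply: measurable_funTS; apply/measurable_EFinP; exact: sub_measurable_fun.
apply: filterS => t Z0; rewrite leNgt; apply/negP => /[dup] /Z0/= Zt.
by rewrite VE Zt add0e ltNge E0.
Qed.

Lemma cond_CVaR_ae0 (alpha : R) (X : T -> \bar R) :
  (0 < alpha < 1)%R -> measurable_fun setT X -> (forall t, 0 <= X t) ->
  {ae P, forall t, X t = 0} -> is_cond_CVaR P G alpha X (cst 0).
Proof.
move=> halpha mX X0 Xae0; split.
- exact: sub_measurable_cst.
- exists (cst 0%R), (cst 0); split.
  + split; first exact: sub_measurable_cst.
    by rewrite Lfun_cst.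
  + exists (cst 0); last by move=> t; rewrite add0e.
    split => //; first exact: sub_measurable_cst.
    move=> B /Gm mB; apply: ae_eq_integral => //.
      apply: measurable_funTS; apply: emeasurable_funM => //.
      apply: measurable_maxe => //; by apply: (emeasurable_funB (g := cst 0)).
    apply: filterS Xae0 => t Xt _.
    by rewrite Xt /= sube0 maxxx mul0e.
  + exact: aeW.
- by move=> Z V; exact: objective_ge0.
Qed.

End conditional_CVaR_theory.

(** * The information available at each stage *)

Section info_theory.
Context {R : realType} {m T : nat} d {Omega : measurableType d}.
Variable F : nat -> set (set Omega).

Lemma sigma_algebra_info t : sigma_algebra setT (@info R m _ _ F T t).
Proof.
case: t => [|t]; last exact: smallest_sigma_algebra.
split => /=; first by left.
  by move=> B [->|->]; [right; rewrite setD0|left; rewrite setDv].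
move=> B hB.
have [[i Bi]|nB] := pselect (exists i, B i = setT).
  right; apply/seteqP; split => // z _; exists i => //; by rewrite Bi.
left; apply/seteqP; split => // z [i _].
by have [->//|Bi] := hB i; case: nB; exists i.
Qed.

Lemma info_measurable t : filtration F ->
  @info R m _ _ F T t `<=` measurable.
Proof.
move=> [_ Fm _]; case: t => [B [->|->]|t].
- exact: measurable0.
- exact: measurableT.
apply: smallest_sub; first exact: sigma_algebra_measurable.
move=> E [[B FB ->]|[i [C [_ mC ->]]]]; rewrite -[X in measurable X]setTI.
  by apply: measurable_fst => //; exact: (Fm t).
exact: measurable_control.
Qed.

End info_theory.

(** * Almost sure safety *)

Lemma probability_ge1_ae d (T : measurableType d) (R : realType)
    (P : probability T R) (E : set T) : measurable E ->
  (1 <= P E)%E <-> {ae P, forall t, E t}.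
Proof.
move=> mE; split => [E1|[B [mB B0 EB]]].
  exists (~` E); split => //; first exact: measurableC.
  rewrite probability_setC//; have -> : P E = 1%E.
    by apply/eqP; rewrite eq_le probability_le1.
  by rewrite subee.
have EC0 : P (~` E) = 0%E.
  by apply: (@subset_measure0 _ _ _ P _ B) => //; exact: measurableC.
by rewrite -[E]setCK probability_setC ?EC0 ?sube0//; exact: measurableC.
Qed.

Section safe_sets.
Context {R : realType} {n m l T : nat} d {Omega : measurableType d}.
Variables (f : {mfun ('rV[R]_n * 'rV[R]_m * 'rV[R]_l)%type >-> 'rV[R]_n})
  (w : nat -> {mfun Omega >-> 'rV[R]_l}) (A : set 'rV[R]_n).

(** Swaps the quantifier over the finitely many stages with the almost sure
one, and shifts from the stages 1, ..., T of the safety event to the successors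
of 0, ..., T - 1 that occur in the risk constraint. *)
Lemma safe_event_probability1P (Q : probability (@sample R m _ Omega T) R) x :
  measurable A ->
  (1 <= Q [set z | forall t, (1 <= t <= T)%N -> A (state f w x t z)])%E <->
  forall t, (t < T)%N -> {ae Q, forall z, A (state f w x t.+1 z)}.
Proof.
move=> mA; rewrite probability_ge1_ae; last first.
  rewrite (_ : [set z | _] =
      \bigcap_t [set z | (1 <= t <= T)%N -> A (state f w x t z)]).
    apply: bigcapT_measurable => t.
    case: (boolP (1 <= t <= T)%N) => [tT|_].
      rewrite (_ : [set z | _] = setT `&` state f w x t @^-1` A).
        exact: measurable_state.
      by apply/seteqP; split => z /=; [move/(_ isT)|case].
    by rewrite (_ : [set z | _] = setT)//; apply/seteqP; split.
  by apply/seteqP; split => z /= h t; [move=> _; exact: h|exact: h].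
split=> [h t tT|h].
  by apply: filterS h => z; apply; rewrite /= tT.
have : {ae Q, forall z, forall t, (t < T)%N -> A (state f w x t.+1 z)}.
  apply: ae_foralln => t; have [tT|_] := ltnP t T; last exact: aeW.
  by apply: filterS (h _ tT).
by apply: filterS => z hz [//|t]; exact: hz.
Qed.

End safe_sets.

Theorem proposition2 (R : realType) (n m l T : nat)
    (d : measure_display) (Omega : measurableType d) (P : probability Omega R)
    (F : nat -> set (set Omega))
    (f : {mfun ('rV[R]_n * 'rV[R]_m * 'rV[R]_l)%type >-> 'rV[R]_n})
    (w : nat -> {mfun Omega >-> 'rV[R]_l})
    (U : set 'rV[R]_m) (W : set 'rV[R]_l) (A : set 'rV[R]_n)
    (alpha : R)
    (hF : filtration F)
    (hw : forall t, sub_measurable (F t) (w t))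
    (hW : forall t omega, W (w t omega))
    (hU : convex_set (U : set (convex_lmodType 'rV[R]_m)))
    (mU : measurable U)
    (hA : convex_set (A : set (convex_lmodType 'rV[R]_n)))
    (cA : compact A)
    (mA : measurable A)
    (halpha : 0 < alpha < 1) :
  risk_safe_set f w P F U W T A alpha 0
    `<=` prob_safe_set f w P U W T A alpha /\
  (risk_safe_set f w P F U W T A alpha 0 = prob_safe_set f w P U W T A 1 /\
   prob_safe_set f w P U W T A 1 `<=` prob_safe_set f w P U W T A alpha).
Proof.
have closedA : closed A by apply: compact_closed => //; exact: norm_hausdorff.
have mdist x t : measurable_fun setT
    (fun z : sample T => dist (state f w x t z) A).
  exact: measurableT_comp (measurable_dist A) (measurable_state _ _ _ _).
have RS1 : risk_safe_set f w P F U W T A alpha 0 =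
           prob_safe_set f w P U W T A 1.
  apply/seteqP; split => x [pi adm h]; exists pi => //.
    apply/safe_event_probability1P => // t tT; have [Y cY Y0] := h t tT.
    have : {ae policy_prob f w P x pi T,
              forall z, dist (state f w x t.+1 z) A = 0%E}.
      apply: cond_CVaR_le0 halpha _ _ cY Y0 => //.
      - exact: sigma_algebra_info.
      - exact: info_measurable.
      - by move=> z; exact: dist_ge0.
    by apply: filterS => z /(dist_eq0 _ closedA).
  move=> t tT; exists (cst 0%E); last exact: aeW.
  apply: cond_CVaR_ae0 => //.
  - exact: sigma_algebra_info.
  - exact: info_measurable.
  - by move=> z; exact: dist_ge0.
  have /safe_event_probability1P -/(_ mA t tT) := h.
  by apply: filterS => z /(dist_eq0 _ closedA).
have S1 : prob_safe_set f w P U W T A 1 `<=` prob_safe_set f w P U W T A alpha.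
  move=> x [pi adm h]; exists pi => //; apply: le_trans h.
  by rewrite lee_fin; have /andP[_ /ltW] := halpha.
by rewrite RS1.
Qed.
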